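(* For each $n \in \mathbf{N}$, let $m_n \in \mathbf{N}$ and let $X_{n,1}, \ldots, X_{n,m_n}$ be independent real-valued random variables with mean zero. Let $Z$ be a standard normal random variable. If \[ \sum_{i=1}^{m_n} \mathbf{E}[X_{n,i}^2] = 1 \qquad \text{for all } n \in \mathbf{N} \] and \[ \lim_{n\to\infty} \sum_{i=1}^{m_n} \mathbf{E}\left[X_{n,i}^2; |X_{n,i}| > \delta\right] = 0 \qquad \text{for all } \delta > 0, \] then \[ \lim_{n\to\infty} \mathbf{P}\left(\sum_{i=1}^{m_n} X_{n,i} \le x\right) = \mathbf{P}(Z \le x) \qquad \text{for all } x \in \mathbf{R}. \]
   Context: A standard normal random variable $Z$ is a continuous real-valued random variable with density $f_Z(t) = \frac{e^{-t^2/2}}{\sqrt{2\pi}}$ for all $t \in \mathbf{R}$. $\mathbf{P}$ denotes probability and $\mathbf{E}$ denotes expectation. For a random variable $R$ and an event $A$, $\mathbf{E}[R;A] := \mathbf{E}[R 1_A]$, where $1_A$ is the indicator of $A$. Independence is assumed only within each row, i.e. among $X_{n,1},\ldots,X_{n,m_n}$ for each fixed $n$. *)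

(* Defs.v *)
From HB Require Import structures.
From mathcomp Require Import all_boot all_order all_algebra.
From mathcomp Require Import all_classical all_reals all_analysis.

Set Implicit Arguments.
Unset Strict Implicit.
Unset Printing Implicit Defensive.

Import Order.TTheory GRing.Theory Num.Theory.
Import numFieldNormedType.Exports.

Local Open Scope classical_set_scope.
Local Open Scope ring_scope.

Definition independent_RVs (R : realType) (d : measure_display)
    (T : measurableType d) (P : probability T R) (I : finType)
    (X : I -> {RV P >-> R}) : Prop :=
  forall (J : {set I}) (B : I -> set R), (forall i, measurable (B i)) ->
    P (\bigcap_(i in [set` J]) (X i @^-1` B i)) =
      (\prod_(i in J) P (X i @^-1` B i))%E.
Arguments independent_RVs {R d T} P {I} X.

(* E[Y; A] *)
Definition expectation_on (R : realType) (d : measure_display)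
    (T : measurableType d) (P : probability T R) (Y : T -> R) (A : set T)
    : \bar R :=
  'E_P[fun w => Y w * \1_A w].

(* [normal_prob 0 1] is the measure with Lebesgue density
   t |-> exp (- t ^ 2 / 2) / sqrt (2 * pi). *)
Definition standard_normal (R : realType) (d : measure_display)
    (T : measurableType d) (P : probability T R) (Z : {RV P >-> R}) : Prop :=
  forall A : set R, measurable A -> distribution P Z A = normal_prob 0 1 A.
Arguments standard_normal {R d T} P Z.

(* Main.v *)
Require Import Defs.
From HB Require Import structures.
From mathcomp Require Import all_boot all_order all_algebra.
From mathcomp Require Import all_classical all_reals all_analysis.
From mathcomp Require Import measurable_realfun ring lra.

Set Implicit Arguments.
Unset Strict Implicit.
Unset Printing Implicit Defensive.

Import Order.TTheory GRing.Theory Num.Theory.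
Import numFieldNormedType.Exports.

Local Open Scope classical_set_scope.
Local Open Scope ring_scope.

(** Stein's method.  Write W_n for the row sum and phi for the standard normal
density.  For a continuous compactly supported h with zero Gaussian mean, the
solution f = phi^-1 * (integral of h * phi over ]-oo, x]) of
f'(x) - x f(x) = h(x) also has compact support, so f' is bounded and uniformly
continuous.  Put U_i = W_n - X_i.  Independence and centering give
E[X_i f(U_i)] = 0 and E[X_i^2 f'(U_i)] = E[X_i^2] E[f'(U_i)], so expanding
f(U_i + X_i) to first order bounds E[f'(W_n) - W_n f(W_n)] by the modulus of
continuity of f' plus a multiple of the Lindeberg sum; hence E[h(W_n)] -> 0.
A general h is centered by subtracting a multiple of a wide bump, whose
expectation under W_n is close to 1 because E[W_n^2] = 1.  This gives lower
bounds for the probabilities of open half-lines, and both half-lines together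
give the convergence of the distribution functions. *)

(** * Stein's equation *)

Lemma is_derive_continuous (R : realType) (f g : R -> R) :
  (forall x : R, is_derive x 1 f (g x)) -> continuous f.
Proof.
move=> df x; apply: differentiable_continuous.
by apply/derivable1_diffP; case: (df x).
Qed.

(** Heine-Cantor on a segment one unit wider than the support; beyond that segment both values of
    [g] vanish once the two points are less than 1 apart. *)
Lemma compact_support_unif_continuous (R : realType) (g : R -> R) (A : R) :
  continuous g -> (forall x, A < `|x| -> g x = 0) ->
  forall e : R, 0 < e ->
    exists2 dl : R, 0 < dl & forall x y, `|x - y| <= dl -> `|g x - g y| <= e.
Proof.
move=> cg g0 e e0.
pose K := `[- A - 1, A + 1]%classic : set R.
have /compact_near_coveringP : compact K by exact: segment_compact.
(* The near-covering form of compactness, along the right neighbourhoods of 0, turns local moduli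
   into a single [dl] valid for every [x] in [K], with [y] unrestricted. *)
move=> /(_ R 0^'+ (fun dl x => forall y, `|x - y| <= dl -> `|g x - g y| <= e)).
case=> [x _|dl /= dl0 dlP].
  have /cvgrPdist_lt /(_ (e / 2)) := cg x.
  rewrite divr_gt0// => /(_ isT) [r /= r0 rP].
  (* Half of the radius goes to the moving point and half to [dl], so that both points stay within
     [r] of the centre [x]. *)
  exists (ball x (r / 2),
    (ball (0 : R) (r / 2) `&` (`]0, +oo[%classic : set R))) => /=.
    split; first by apply: nbhsx_ballx; rewrite divr_gt0.
    exists (r / 2) => /=; first by rewrite divr_gt0.
    by move=> t rt t0; split => //=; rewrite in_itv/= andbT.
  move=> [x' t] /= [xx' [t0 _]] y x'y.
  rewrite /ball/= in xx' t0; rewrite sub0r normrN in t0.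
  have tr : t < r / 2 by rewrite (le_lt_trans _ t0)// ler_norm.
  have h1 : `|g x - g x'| < e / 2 by apply: rP => /=; lra.
  have h2 : `|g x - g y| < e / 2.
    apply: rP => /=; rewrite (le_lt_trans (ler_distD x' x y))// (splitr r).
    by rewrite ltr_leD// (le_trans x'y)// ltW.
  rewrite (le_trans (ler_distD (g x) _ _))// (splitr e) lerD//; last exact: ltW.
  by rewrite distrC ltW.
pose t := Num.min (dl / 2) (1/2).
have t0 : 0 < t by rewrite lt_min divr_gt0// divr_gt0.
have t2 : t <= 1/2 by rewrite ge_min lexx orbT.
exists t => // x y xy.
have [xA|xA] := lerP `|x| (A + 1).
  have Kx : K x.
    by rewrite /K/= in_itv/=; move: xA; rewrite ler_norml => /andP[]; lra.
  have tdl : ball_ Num.norm 0 dl t.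
    rewrite /= sub0r normrN gtr0_norm// gt_min.
    by rewrite ltr_pdivrMr// ltr_pMr// ltr1n.
  exact: (dlP t tdl t0 x Kx).
rewrite (g0 x); last lra.
rewrite (g0 y) ?subrr ?normr0 ?ltW//.
have := ler_distD y x 0; rewrite !subr0; lra.
Qed.

Lemma compact_support_bounded (R : realType) (g : R -> R) (A : R) :
  continuous g -> (forall x, A < `|x| -> g x = 0) ->
  exists2 B, 0 <= B & forall x, `|g x| <= B.
Proof.
move=> cg g0.
(* The bound [|A|] replaces [A] to keep the segment nonempty when [A] is negative. *)
have [||c _ cP] := @EVT_max R (fun x => `|g x|) (- `|A|) `|A|.
- by rewrite ge0_cp ?normr_ge0.
- apply: continuous_subspaceT => x.
  by apply: cvg_norm; exact: cg.
exists `|g c| => // x.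
have [xA|xA] := lerP `|x| `|A|; last first.
  by rewrite g0 ?normr0// (le_lt_trans (ler_norm _)).
by apply: cP; rewrite in_itv/= -ler_norml.
Qed.

Lemma is_derive_expR_halfsqr (R : realType) (x : R) :
  is_derive x 1 (fun x : R => expR (x ^+ 2 / 2)) (x * expR (x ^+ 2 / 2)).
Proof.
have dx2 : is_derive x 1 (fun x : R => x ^+ 2 / 2) x.
  by apply: is_derive_eq; rewrite /GRing.scale/=; field.
have := @is_derive1_comp R expR _ x _ _ (is_derive_expR _) dx2.
by rewrite mulrC.
Qed.

Section stein_equation.
Variable R : realType.
Notation mu := (@lebesgue_measure R).
Notation phi := (normal_pdf (0 : R) 1).

Let phiE x : phi x = normal_peak 1 * expR (- x ^+ 2 / 2).
Proof.
rewrite normal_pdfE ?oner_eq0// /normal_fun subr0 expr1n.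
by [].
Qed.

Lemma integrableM_normal_pdf (h : R -> R) (B : R) :
  measurable_fun setT h -> (forall x, `|h x| <= B) ->
  mu.-integrable setT (fun x => (h x * phi x)%:E).
Proof.
move=> mh hB.
have iB : mu.-integrable setT (fun x => (B * phi x)%:E).
  under eq_fun do rewrite EFinM.
  by apply: integrableZl => //; exact: integrable_normal_pdf.
apply: (le_integrable measurableT _ _ iB).
- by apply/measurable_EFinP/measurable_funM => //; exact: measurable_normal_pdf.
- move=> x _; rewrite /= lee_fin !normrM ler_wpM2r// (le_trans (hB _))//.
  exact: ler_norm.
Qed.

(** The density is an integrating factor: [(phi * f)' = phi * (f' - x * f)], so [phi * f] has to be
    a primitive of [h * phi]. Taking [g] to be [h x + x * f x] makes its continuity and its support
    immediate. *)
Lemma stein_equation (h : R -> R) (A : R) :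
  continuous h -> (forall x, A < `|x| -> h x = 0) ->
  (\int[mu]_x (h x * phi x) = 0)%R ->
  exists f g : R -> R, [/\ continuous g, forall x : R, is_derive x 1 f (g x),
    forall x, A < `|x| -> f x = 0, forall x, A < `|x| -> g x = 0 &
    forall x, g x - x * f x = h x].
Proof.
move=> ch h0 ih0.
have [B B0 hB] := compact_support_bounded ch h0.
have mh : measurable_fun setT h by exact: continuous_measurable_fun.
have ih := integrableM_normal_pdf mh hB.
pose F x := (\int[mu]_(t in `]-oo, x]) (h t * phi t))%R.
have ch' : continuous (fun t => h t * phi t).
  by move=> x; apply: cvgM; [exact: ch|exact: continuous_normal_pdf].
have dF (x : R) : is_derive x 1 F (h x * phi x).
  have [] := @continuous_FTC1 R (fun t => h t * phi t) -oo%O x (x + 1) _ _ _ _.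
  - by rewrite ltrDl.
  - by apply: (integrableS measurableT) => //=.
  - by rewrite ltNyr.
  - exact: ch'.
  move=> F1 F'; apply: DeriveDef; first exact: F1.
  by rewrite -derive1E; exact: F'.
have cn0 : normal_peak (1:R) != 0 by rewrite gt_eqF// normal_peak_gt0 ?oner_eq0.
(* This is [F / phi], with the inverse of the density written out. *)
pose f x := (normal_peak 1)^-1 * (expR (x ^+ 2 / 2) * F x).
have df (x : R) : is_derive x 1 f (h x + x * f x).
  rewrite /f.
  have de := is_derive_expR_halfsqr x.
  apply: is_derive_eq.
  rewrite /GRing.scale/= phiE.
  have -> : - x ^+ 2 / 2 = - (x ^+ 2 / 2) by field.
  by rewrite expRN; field; rewrite cn0 gt_eqF ?expR_gt0.
have F0 x : A < `|x| -> F x = 0.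
  have [x0|x0] := leP 0 x.
    (* To the right of the support [F x] is already the whole integral, which is zero because [h] is
       centered; to the left, treated next, the integrand itself vanishes. *)
    rewrite ger0_norm// => Ax; rewrite -ih0 /F Rintegral_mkcond.
    apply: eq_Rintegral => t _; rewrite patchE; case: ifPn => //.
    rewrite notin_setE/= in_itv/= => /negP; rewrite -ltNge => xt.
    by rewrite h0 ?mul0r// (lt_trans Ax)// (lt_le_trans xt)// ler_norm.
  rewrite ltr0_norm// => Ax.
  transitivity (\int[mu]_(t in `]-oo, x]) (0 : R))%R; last first.
    by rewrite Rintegral_cst// mul0r.
  apply: eq_Rintegral => t; rewrite inE/= in_itv/= => tx.
  rewrite h0 ?mul0r// (lt_le_trans Ax)// -normrN (le_trans _ (ler_norm _))//.
  by rewrite lerN2.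
have f0 x : A < `|x| -> f x = 0 by move=> Ax; rewrite /f F0// !mulr0.
exists f, (fun x => h x + x * f x); split => //.
- move=> x; apply: cvgD; first exact: ch.
  apply: cvgM; first exact: cvg_id.
  exact: (is_derive_continuous df).
- by move=> x Ax; rewrite h0// f0// mulr0 addr0.
- by move=> x; rewrite addrK.
Qed.

End stein_equation.

(** * Independence *)

Definition independent2 (d : measure_display) (T : measurableType d)
    (R : realType) (P : probability T R) (Y V : T -> R) : Prop :=
  forall A B : set R, measurable A -> measurable B ->
    P (Y @^-1` A `&` V @^-1` B) = (P (Y @^-1` A) * P (V @^-1` B))%E.

Section independence.
Context (d : measure_display) (T : measurableType d) (R : realType).
Variable P : probability T R.

Lemma independent2_comp (Y V : T -> R) (f g : R -> R) :
  measurable_fun setT f -> measurable_fun setT g ->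
  independent2 P Y V -> independent2 P (f \o Y) (g \o V).
Proof.
move=> mf mg YV A B mA mB; apply: (YV (f @^-1` A) (g @^-1` B)).
  by rewrite -[X in measurable X]setTI; exact: mf.
by rewrite -[X in measurable X]setTI; exact: mg.
Qed.

(** The joint law of [(Y, V)] agrees with the product of the marginals on rectangles, hence
    everywhere, and Fubini then factors the integral of the product. *)
Lemma independent2_integralM (Y V : {mfun T >-> R}) :
  independent2 P Y V ->
  P.-integrable setT (EFin \o Y) -> P.-integrable setT (EFin \o V) ->
  P.-integrable setT (EFin \o (Y \* V)) /\
  (\int[P]_w (Y w * V w) = (\int[P]_w Y w) * (\int[P]_w V w))%R.
Proof.
move=> YV iY iV.
have mYV : measurable_fun setT (fun w => (Y w, V w)).
  exact: measurable_fun_pair.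
pose Z : {mfun T >-> (R * R)%type} := mfun_Sub (mem_set mYV).
pose pY := distribution P Y; pose pV := distribution P V.
have pZ (C : set (R * R)) : measurable C -> (pY \x pV)%E C = distribution P Z C.
  apply: product_measure_unique => A B mA mB.
  exact: YV.
pose f (z : R * R) := (z.1 * z.2)%:E.
have mf : measurable_fun setT f.
  apply/measurable_EFinP; apply: measurable_funM.
    exact: measurable_fst.
  exact: measurable_snd.
have iYd : pY.-integrable setT EFin.
  apply: integrable_pushforward => //; exact: iY.
have iVd : pV.-integrable setT EFin.
  apply: integrable_pushforward => //; exact: iV.
(* Integrability of the product is obtained from Tonelli: the iterated integral of the absolute
   value is a product of two finite numbers. *)
have ifp : (pY \x pV)%E.-integrable setT f.
  apply/integrable12ltyP => //.
  under eq_integral => x _.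
    rewrite /f/=.
    under eq_integral => y _ do rewrite normrM EFinM.
    rewrite integralZl//; last exact: integrable_abse iVd.
    over.
  have : (\int[pV]_y (`|y|)%:E)%E \is a fin_num.
    by apply: integrable_fin_num => //; exact: integrable_abse iVd.
  move=> /fineK <-.
  rewrite integralZr//; last exact: integrable_abse iYd.
  rewrite ltey_eq fin_numM//.
  by apply: integrable_fin_num => //; exact: integrable_abse iYd.
have ifZ : P.-integrable setT (f \o Z).
  apply/integrableP; split; first exact: measurableT_comp.
  have /integrableP[_] := ifp.
  rewrite (@eq_measure_integral _ _ _ setT (distribution P Z)); last first.
    by move=> A mA _; exact: pZ.
  rewrite ge0_integral_pushforward//.
  exact: measurableT_comp.
split; first exact: ifZ.
rewrite /Rintegral -fineM; last 2 first.
- exact: integrable_fin_num.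
- exact: integrable_fin_num.
congr fine.
have -> : (\int[P]_w (Y w)%:E)%E = (\int[pY]_x x%:E)%E.
  by rewrite integral_pushforward.
have -> : (\int[P]_w (V w)%:E)%E = (\int[pV]_x x%:E)%E.
  by rewrite integral_pushforward.
transitivity (\int[(pY \x pV)%E]_z f z)%E.
  rewrite (@eq_measure_integral _ _ _ setT (distribution P Z)); last first.
    by move=> A mA _; exact: pZ.
  by rewrite integral_pushforward.
rewrite -integral12_prod_meas1// /fubini_F/=.
under eq_integral => x _.
  rewrite /f/=.
  under eq_integral => y _ do rewrite EFinM.
  rewrite integralZl//.
  over.
have : (\int[pV]_y y%:E)%E \is a fin_num by exact: integrable_fin_num.
by move=> /fineK <-; rewrite integralZr.
Qed.

(** Dynkin's pi-lambda argument: the cylinders [G] in the coordinates other than [i] are stable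
    under intersection, the events [H] independent of [X i] form a Dynkin system, and the partial
    sum is measurable for the sigma-algebra generated by [G]. *)
Lemma independent_RVs_sum (I : finType) (X : I -> {RV P >-> R}) :
  independent_RVs P X ->
  forall i, independent2 P (X i) (fun w => \sum_(j | j != i) X j w).
Proof.
move=> indX i A B mA mB.
pose G : set (set T) := [set E | exists2 C : I -> set R,
  (forall j, measurable (C j)) &
  E = \bigcap_(j in [set` [set~ i]%SET]) (X j @^-1` C j)].
pose H : set (set T) := [set E | measurable E /\
  forall A : set R, measurable A ->
    P (X i @^-1` A `&` E) = (P (X i @^-1` A) * P E)%E].
have mX j (C : set R) : measurable C -> measurable (X j @^-1` C).
  by move=> mC; rewrite -[X in measurable X]setTI; exact: measurable_funP.
have GH : G `<=` H.
  move=> _ [C mC ->]; split.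
    by apply: fin_bigcap_measurable => // j _; exact: mX.
  move=> D mD.
  (* Inserting [D] at coordinate [i] lets the same family serve for the full index set and for the
     complement of [i]. *)
  pose C' j := if j == i then D else C j.
  have mC' j : measurable (C' j) by rewrite /C'; case: ifP.
  have CC' : \bigcap_(j in [set` [set~ i]%SET]) (X j @^-1` C j) =
      \bigcap_(j in [set` [set~ i]%SET]) (X j @^-1` C' j).
    by apply: eq_bigcapr => j /=; rewrite !inE /C' => /negbTE ->.
  have := indX [set: I]%SET C' mC'.
  rewrite (_ : [set` [set: I]%SET] = i |` [set` [set~ i]%SET]); last first.
    apply/seteqP; split => j //= _; rewrite !inE/=.
    by have [->|ji] := eqVneq j i; [left|right].
  rewrite bigcap_setU1 -CC' {1}/C' eqxx => ->.
  rewrite CC' (indX _ _ mC') (bigD1 i) ?inE//= {1}/C' eqxx.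
  by congr (_ * _)%E; apply: eq_bigl => j; rewrite !inE.
have GI : setI_closed G.
  move=> _ _ [C mC ->] [D mD ->]; exists (fun j => C j `&` D j).
    by move=> j; exact: measurableI.
  by rewrite -bigcapI.
have dH : dynkin H.
  split.
  - split => // D mD; rewrite setIT probability_setT mule1//.
  - move=> E [mE HE]; split; first exact: measurableC.
    move=> D mD; have mXD := mX i D mD.
    have PXD : P (X i @^-1` D) \is a fin_num by exact: fin_num_measure.
    rewrite -setDE measureD//; last by rewrite ltey_eq PXD.
    transitivity (P (X i @^-1` D) - P (X i @^-1` D) * P E)%E.
      by congr (_ - _)%E; exact: HE.
    rewrite probability_setC// muleBr ?mule1//.
  - move=> F tF HF; have mF n : measurable (F n) by case: (HF n).
    split; first exact: bigcupT_measurable.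
    move=> D mD; rewrite setI_bigcupr !measure_bigcup//; last 2 first.
    + by move=> n _; apply: measurableI => //; exact: mX.
    + exact: trivIset_setIl.
    have /fineK <- : P (X i @^-1` D) \is a fin_num.
      by apply: fin_num_measure; exact: mX.
    rewrite -nneseriesZl//; apply: eq_eseriesr => n _.
    rewrite fineK; last by apply: fin_num_measure; exact: mX.
    by have [_] := HF n; exact.
have sGH : <<s G >> `<=` H.
  rewrite -setI_closed_g_dynkin_g_sigma_algebra//.
  exact: smallest_sub.
have mG j : j != i ->
    measurable_fun (setT : set (g_sigma_algebraType G)) (X j : _ -> R).
  move=> ji _ D mD; rewrite setTI; apply: sub_sigma_algebra.
  exists (fun k => if k == j then D else setT) => [k|].
    by case: ifP.
  apply/seteqP; split => [w /= wD k /=|w /= /(_ j)].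
    by case: eqP => [->|].
  rewrite eqxx /= => jD; apply: jD.
  by rewrite !inE.
have mW : measurable_fun (setT : set (g_sigma_algebraType G))
    (fun w => \sum_(j | j != i) X j w).
  under eq_fun do rewrite big_mkcond.
  apply: measurable_sum => j; have [->|ji] := eqVneq j i.
    exact: measurable_cst.
  exact: mG.
suff : H ((fun w => \sum_(j | j != i) X j w) @^-1` B) by case => _; exact.
by apply: sGH; have := mW measurableT B mB; rewrite setTI.
Qed.

End independence.

(** * The Stein discrepancy of a row *)

(** By the mean value theorem the left side is [x ^+ 2 * (g c - g u)] up to absolute value, with [c]
    at distance at most [|x|] from [u]: the modulus of continuity handles small [x], the bound
    [2 * B] the others. *)
Lemma taylor1_modulus (R : realType) (f g : R -> R) (B e dl : R) :
  (forall x : R, is_derive x 1 f (g x)) -> 0 <= e -> 0 < dl ->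
  (forall x, `|g x| <= B) ->
  (forall x y, `|x - y| <= dl -> `|g x - g y| <= e) ->
  forall x u, `|x * (f (x + u) - f u - x * g u)| <=
    e * x ^+ 2 + 2 * B * (x ^+ 2 * (dl < `|x|)%R%:R).
Proof.
move=> df e0 dl0 gB ge x u.
have cf := is_derive_continuous df.
have [c cx ->] : exists2 c, `|c - u| <= `|x| & f (x + u) - f u = x * g c.
  have [x0|x0] := leP 0 x.
    have [||c] := @MVT_segment R f g u (x + u).
    - by rewrite lerDr.
    - exact: continuous_subspaceT.
    rewrite in_itv/= => /andP[uc cxu] ->; exists c.
      by rewrite !ger0_norm ?subr_ge0// lerBlDr.
    by rewrite addrK mulrC.
  have [||c] := @MVT_segment R f g (x + u) u.
  - by rewrite gerDr ltW.
  - exact: continuous_subspaceT.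
  rewrite in_itv/= => /andP[uc cxu] fE; exists c.
    rewrite ler0_norm ?subr_le0// ltr0_norm// opprB.
    lra.
  rewrite -opprB fE; ring.
have -> : x * (x * g c - x * g u) = x ^+ 2 * (g c - g u) by ring.
rewrite normrM (ger0_norm (sqr_ge0 _)).
have x20 := sqr_ge0 x.
have B0 : 0 <= B by rewrite (le_trans _ (gB 0)).
have [xdl|xdl] := ltP dl `|x|.
  have h : `|g c - g u| <= 2 * B.
    by have := ler_normB (g c) (g u); have := gB c; have := gB u; lra.
  rewrite mulr1 (le_trans (ler_wpM2l x20 h))//.
  by rewrite mulrC lerDr mulr_ge0.
rewrite mulr0 mulr0 addr0 mulrC ler_wpM2r// ge//.
exact: le_trans xdl.
Qed.

(** * Integrability and integrals of real-valued functions under a probability *)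

Section real_integrals.
Context (d : measure_display) (T : measurableType d) (R : realType).
Variable P : probability T R.
Local Notation intble F := (P.-integrable setT (EFin \o F)).

Lemma intble_measurable (F : T -> R) : intble F -> measurable_fun setT F.
Proof. by move=> /integrableP[/measurable_EFinP]. Qed.

Lemma intble_le (F G : T -> R) : measurable_fun setT F -> intble G ->
  (forall w, `|F w| <= G w) -> intble F.
Proof.
move=> mF iG FG; apply: (le_integrable measurableT _ _ iG).
  exact/measurable_EFinP.
by move=> w _; rewrite /= lee_fin (le_trans (FG w))// ler_norm.
Qed.

Lemma intble_cst (r : R) : intble (fun=> r).
Proof. exact: finite_measure_integrable_cst. Qed.

Lemma intbleD (F G : T -> R) : intble F -> intble G ->
  intble (fun w => F w + G w).
Proof. by move=> iF iG; exact: (integrableD _ iF iG). Qed.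

Lemma intbleB (F G : T -> R) : intble F -> intble G ->
  intble (fun w => F w - G w).
Proof. by move=> iF iG; exact: (integrableB _ iF iG). Qed.

Lemma intbleZ (r : R) (F : T -> R) : intble F -> intble (fun w => r * F w).
Proof. by move=> iF; exact: (integrableZl _ r iF). Qed.

Lemma intble_norm (F : T -> R) : intble F -> intble (fun w => `|F w|).
Proof. by move=> iF; exact: (integrable_abse iF). Qed.

Lemma intble_bounded (F : T -> R) (B : R) :
  measurable_fun setT F -> (forall w, `|F w| <= B) -> intble F.
Proof. by move=> mF FB; apply: (intble_le mF (intble_cst B)). Qed.

Lemma intbleMb (F k : T -> R) (B : R) : intble F -> measurable_fun setT k ->
  (forall w, `|k w| <= B) -> intble (fun w => F w * k w).
Proof.
move=> iF mk kB; apply: (intble_le _ (intbleZ B (intble_norm iF))).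
  by apply: measurable_funM => //; exact: intble_measurable.
by move=> w; rewrite normrM mulrC ler_wpM2r.
Qed.

Lemma intble_sqr_tail (Y : {mfun T >-> R}) (dl : R) :
  intble (fun w => Y w ^+ 2) ->
  intble (fun w => Y w ^+ 2 * \1_[set w | dl < `|Y w|] w).
Proof.
move=> iY2; apply: (intbleMb (B := 1) iY2).
  apply: measurable_indic.
  have -> : [set w | dl < `|Y w|] = (fun w => dl < `|Y w|) @^-1` [set true].
    by apply/seteqP; split => w /=.
  rewrite -[X in measurable X]setTI.
  by apply: measurable_fun_ltr => //; exact: measurableT_comp.
by move=> w; rewrite indicE; case: (_ \in _); rewrite ?normr1 ?normr0.
Qed.

Lemma intble_sum (I : finType) (F : I -> T -> R) :
  (forall i, intble (F i)) -> intble (fun w => \sum_i F i w).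
Proof.
move=> iF; have := @integrable_sum _ _ _ P setT measurableT I
  (index_enum I) xpredT (fun i => EFin \o F i) (fun i _ => iF i).
by under eq_fun do rewrite sumEFin.
Qed.

Lemma Rintegral_sum (I : finType) (F : I -> T -> R) :
  (forall i, intble (F i)) ->
  (\int[P]_w (\sum_i F i w))%R = \sum_i (\int[P]_w F i w)%R.
Proof.
move=> iF; rewrite /Rintegral sum_fine; last first.
  by move=> i _; exact: (integrable_fin_num measurableT (iF i)).
congr fine; rewrite -(@integral_sum _ _ _ P setT measurableT I
  (fun i => EFin \o F i) iF (index_enum I) xpredT).
by apply: eq_integral => w _; rewrite sumEFin.
Qed.

Lemma Rintegral_probability_cst (r : R) : (\int[P]_w r)%R = r.
Proof.
transitivity (r * fine (P setT)); first exact: Rintegral_cst.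
by rewrite probability_setT mulr1.
Qed.

Lemma ler_norm_Rintegral (F G : T -> R) : intble F -> intble G ->
  (forall w, `|F w| <= G w) -> `|(\int[P]_w F w)%R| <= (\int[P]_w G w)%R.
Proof.
move=> iF iG FG; rewrite (le_trans (le_normr_Rintegral _ iF))//.
by apply: le_Rintegral => //; exact: intble_norm.
Qed.

End real_integrals.

(** * Second moment and Stein bound of a row of independent centered variables *)

Section stein_bound.
Context (d : measure_display) (T : measurableType d) (R : realType).
Variables (P : probability T R) (I : finType) (X : I -> {RV P >-> R}).
Local Notation intble F := (P.-integrable setT (EFin \o F)).
Local Notation E F := (\int[P]_w F w)%R.
Local Notation W w := (\sum_i X i w).
Local Notation U i w := (\sum_(j | j != i) X j w).

Hypothesis indX : independent_RVs P X.
Hypothesis iX2 : forall i, intble (fun w => X i w ^+ 2).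
Hypothesis X_mean0 : forall i, E (X i) = 0.
Hypothesis X_var1 : \sum_i E (fun w => X i w ^+ 2) = 1.

Let iX i : intble (X i).
Proof.
apply: (intble_le _ (intbleD (intble_cst P 1) (iX2 i))) => // w.
have [x1|x1] := lerP `|X i w| 1; first by rewrite (le_trans x1)// lerDl sqr_ge0.
have x2 : `|X i w| <= `|X i w| ^+ 2 by apply: ler_eXnr => //; exact: ltW.
rewrite (le_trans x2)//.
by rewrite real_normK ?num_real// lerDr.
Qed.

Let mW : measurable_fun setT (fun w => W w).
Proof. exact: measurable_sum. Qed.

Let mU i : measurable_fun setT (fun w => U i w).
Proof.
under eq_fun do rewrite big_mkcond.
by apply: measurable_sum => j; case: (j != i).
Qed.

Let WE i w : W w = X i w + U i w.
Proof. by rewrite (bigD1 i). Qed.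

Let indep_E i (f k : R -> R) :
  measurable_fun setT f -> measurable_fun setT k ->
  intble (f \o X i) -> intble (k \o (fun w => U i w)) ->
  E (fun w => f (X i w) * k (U i w)) = E (f \o X i) * E (k \o (fun w => U i w)).
Proof.
move=> mf mk iF iK.
have mfX : measurable_fun setT (f \o X i) by exact: measurableT_comp.
have mkU : measurable_fun setT (k \o (fun w => U i w)).
  exact: measurableT_comp.
have [] := @independent2_integralM _ _ _ P (mfun_Sub (mem_set mfX))
  (mfun_Sub (mem_set mkU)) _ iF iK => //.
exact: (independent2_comp mf mk (independent_RVs_sum indX i)).
Qed.

(** Expanding the square as the sum of the [X i * (X i + U i)] leaves one cross term per index, and
    each has zero mean by independence and centering. This normalization later gives the tail
    control of the row sum. *)
Lemma sum_sqr_expectation :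
  intble (fun w => W w ^+ 2) /\ E (fun w => W w ^+ 2) = 1.
Proof.
have iU i : intble (fun w => U i w).
  have -> : (fun w => U i w) = (fun w => W w - X i w).
    by apply/funext => w; rewrite (WE i) addrAC subrr add0r.
  by apply: intbleB => //; exact: intble_sum.
have XXi i : intble (fun w => X i w * U i w) /\ E (fun w => X i w * U i w) = 0.
  have [h1 h2] := @independent2_integralM _ _ _ P (X i)
    (mfun_Sub (mem_set (mU i))) (independent_RVs_sum indX i) (iX i) (iU i).
  by split; [exact: h1|rewrite h2 X_mean0 mul0r].
have W2E : (fun w => W w ^+ 2) =
    (fun w => \sum_i (X i w ^+ 2 + X i w * U i w)).
  apply/funext => w; rewrite expr2 {1}big_distrl/=.
  by apply: eq_bigr => i _; rewrite (WE i) mulrDr.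
have iS i : intble (fun w => X i w ^+ 2 + X i w * U i w).
  by apply: intbleD => //; case: (XXi i).
rewrite W2E; split; first exact: intble_sum.
rewrite Rintegral_sum// -X_var1; apply: eq_bigr => i _.
have [h1 h2] := XXi i.
by rewrite RintegralD// h2 addr0.
Qed.

(** Two errors are added for each index: the Taylor remainder of [f] at [U i], and the cost of
    replacing [g (W w)] by [g (U i w)]. Each contributes one [e]; the tail contributes [2 * B] to
    the first and, by a Chebyshev estimate, [2 * B * dl ^- 2] to the second. *)
Lemma stein_bound (f g : R -> R) (Bf B e dl : R) :
  continuous g -> (forall x : R, is_derive x 1 f (g x)) ->
  (forall x, `|f x| <= Bf) -> (forall x, `|g x| <= B) ->
  0 <= e -> 0 < dl ->
  (forall x y, `|x - y| <= dl -> `|g x - g y| <= e) ->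
  `|E (fun w => g (W w) - W w * f (W w))| <=
    2 * e + 2 * B * (1 + dl ^- 2) *
      \sum_i E (fun w => X i w ^+ 2 * \1_[set w | dl < `|X i w|] w).
Proof.
move=> cg df fB gB e0 dl0 ge.
have cf := is_derive_continuous df.
have mf : measurable_fun setT f by exact: continuous_measurable_fun.
have mg : measurable_fun setT g by exact: continuous_measurable_fun.
have B0 : 0 <= B by rewrite (le_trans _ (gB 0)).
have Bdl0 : 0 <= 2 * B * dl ^- 2.
  by rewrite !mulr_ge0// invr_ge0 exprn_ge0// ltW.
pose q i w := X i w ^+ 2 * \1_[set w | dl < `|X i w|] w.
have qE i w : q i w = X i w ^+ 2 * (dl < `|X i w|)%R%:R.
  rewrite /q indicE; congr (_ * (nat_of_bool _)%:R).
  by apply/idP/idP; rewrite inE.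
have q0 i w : 0 <= q i w by rewrite qE mulr_ge0// sqr_ge0.
have iq i : intble (q i) by exact: intble_sqr_tail.
have bnd (k : R -> R) (K : R) (V : T -> R) : measurable_fun setT k ->
    measurable_fun setT V -> (forall x, `|k x| <= K) -> intble (k \o V).
  move=> mk mV kK; apply: (@intble_bounded _ _ _ P (k \o V) K).
    exact: measurableT_comp.
  by move=> w; exact: kK.
have igW := bnd g B _ mg mW gB.
have ifU i := bnd f Bf _ mf (mU i) fB.
have igU i := bnd g B _ mg (mU i) gB.
have iXfW i : intble (fun w => X i w * f (W w)).
  by apply: (@intbleMb _ _ _ P _ _ Bf) => //; exact: (measurableT_comp mf mW).
have iXfU i : intble (fun w => X i w * f (U i w)).
  apply: (@intbleMb _ _ _ P _ _ Bf) => //.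
  exact: (measurableT_comp mf (mU i)).
have iXgU i : intble (fun w => X i w ^+ 2 * g (U i w)).
  apply: (@intbleMb _ _ _ P _ _ B) => //.
  exact: (measurableT_comp mg (mU i)).
pose v i := E (fun w => X i w ^+ 2).
have v0 i : 0 <= v i by apply: Rintegral_ge0 => w _; exact: sqr_ge0.
have v1 i : v i <= 1.
  by rewrite -X_var1 (bigD1 i)//= lerDl sumr_ge0// => j _; exact: v0.
(* The variances [v i] sum to 1, so they serve as weights that spread [g (W w)] over the indices. *)
have -> : E (fun w => g (W w) - W w * f (W w)) =
    \sum_i (v i * E (g \o (fun w => W w)) - E (fun w => X i w * f (W w))).
  rewrite RintegralB//; last first.
    under eq_fun do rewrite mulr_suml.
    exact: intble_sum.
  rewrite big_split/= -mulr_suml X_var1 mul1r sumrN -Rintegral_sum//.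
  by congr (_ - _); apply: eq_Rintegral => w _; rewrite mulr_suml.
have term i : `|v i * E (g \o (fun w => W w)) - E (fun w => X i w * f (W w))| <=
    2 * e * v i + 2 * B * (1 + dl ^- 2) * E (q i).
  have h1 : `|E (fun w => X i w ^+ 2 * g (U i w) + X i w * f (U i w)
                - X i w * f (W w))| <= e * v i + 2 * B * E (q i).
    rewrite /v -!RintegralZl// -RintegralD//; [|exact: intbleZ|exact: intbleZ].
    apply: ler_norm_Rintegral.
    - by apply: intbleB => //; exact: intbleD.
    - by apply: intbleD; exact: intbleZ.
    move=> w; rewrite qE (WE i) -normrN.
    have := taylor1_modulus df e0 dl0 gB ge (X i w) (U i w).
    by congr (`|_| <= _); ring.
  have h2 : `|E (fun w => g (W w) - g (U i w))| <=
      e + 2 * B * dl ^- 2 * E (q i).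
    rewrite -{1}(Rintegral_probability_cst P e) -RintegralZl//.
    rewrite -RintegralD//; [|exact: intble_cst|exact: intbleZ].
    apply: ler_norm_Rintegral.
    - exact: (intbleB igW (igU i)).
    - by apply: intbleD; [exact: intble_cst|exact: intbleZ].
    move=> w; rewrite qE.
    have [xdl|xdl] := ltP dl `|X i w|; last first.
      by rewrite !mulr0 addr0 ge// (WE i) addrK.
    rewrite mulr1 -mulrA.
    have h : `|g (W w) - g (U i w)| <= 2 * B.
      have := ler_normB (g (W w)) (g (U i w)).
      by have := gB (W w); have := gB (U i w); lra.
    rewrite (le_trans h)// -[leLHS]add0r lerD// ler_peMr ?mulr_ge0//.
    rewrite mulrC ler_pdivlMr ?exprn_gt0// mul1r.
    rewrite -[leRHS]real_normK ?num_real//.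
    by apply: lerXn2r; rewrite ?nnegrE// ltW.
  (* Independence enters here: the mean of [X i ^+ 2 * g (U i)] is [v i] times that of [g (U i)],
     and [X i * f (U i)] has mean zero. *)
  have -> : v i * E (g \o (fun w => W w)) - E (fun w => X i w * f (W w)) =
      v i * E (fun w => g (W w) - g (U i w)) +
      E (fun w => X i w ^+ 2 * g (U i w) + X i w * f (U i w)
                - X i w * f (W w)).
    have -> : E (fun w => g (W w) - g (U i w)) =
        E (g \o (fun w => W w)) - E (g \o (fun w => U i w)).
      exact: (RintegralB measurableT igW (igU i)).
    have -> : E (fun w => X i w ^+ 2 * g (U i w) + X i w * f (U i w)
        - X i w * f (W w)) = E (fun w => X i w ^+ 2 * g (U i w)) +
        E (fun w => X i w * f (U i w)) - E (fun w => X i w * f (W w)).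
      rewrite -(RintegralD measurableT (iXgU i) (iXfU i)).
      exact: (RintegralB measurableT (intbleD (iXgU i) (iXfU i)) (iXfW i)).
    have mx2 : measurable_fun setT (fun x : R => x ^+ 2).
      exact: exprn_measurable.
    have -> := indep_E mx2 mg (iX2 i) (igU i).
    have -> := indep_E (@measurable_id _ R setT) mf (iX i) (ifU i).
    have -> : E (id \o X i) = 0 by exact: X_mean0.
    by rewrite /v; ring.
  rewrite (le_trans (ler_normD _ _))// normrM (ger0_norm (v0 i)).
  (* The weight is kept on [e], to be summed to 1, and dropped from the tail term using
     [v i <= 1]. *)
  have h3 : v i * `|E (fun w => g (W w) - g (U i w))| <=
      v i * e + 2 * B * dl ^- 2 * E (q i).
    rewrite (le_trans (ler_wpM2l (v0 i) h2))// mulrDr lerD2l ler_piMl//.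
    by rewrite mulr_ge0// Rintegral_ge0// => w _; exact: q0.
  rewrite (le_trans (lerD h3 h1))// le_eqVlt; apply/orP; left; apply/eqP.
  ring.
rewrite (le_trans (ler_norm_sum _ _ _))//.
rewrite (le_trans (ler_sum _ (fun i _ => term i)))//.
by rewrite big_split/= -!mulr_sumr X_var1 mulr1.
Qed.

End stein_bound.

(** * From test functions to distribution functions *)

Section clamp.
Variable R : realType.
Implicit Types x y : R.

Definition clamp x : R := Num.max 0 (Num.min 1 x).

Lemma clamp_ge0 x : 0 <= clamp x.
Proof. by rewrite le_max lexx. Qed.

Lemma clamp_le1 x : clamp x <= 1.
Proof. by rewrite ge_max ler01 ge_min lexx. Qed.

Lemma clamp_le0 x : x <= 0 -> clamp x = 0.
Proof. by move=> x0; apply/max_idPl; rewrite ge_min x0 orbT. Qed.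

Lemma clamp_ge1 x : 1 <= x -> clamp x = 1.
Proof. by move=> x1; rewrite /clamp (min_idPl x1); apply/max_idPr. Qed.

Lemma continuous_clamp (f : R -> R) :
  continuous f -> continuous (fun x => clamp (f x)).
Proof.
move=> cf x; apply: (@continuous_max _ _ (fun=> 0) (fun x => Num.min 1 (f x))).
  exact: cvg_cst.
apply: (@continuous_min _ _ (fun=> 1) f); first exact: cvg_cst.
exact: cf.
Qed.

(** A trapezoidal cutoff: for nonnegative [k] its plateau is [[-k, k]], and it falls linearly to 0
    at distance [k + 1] from the origin. *)
Definition bump (k : R) x := clamp (k + 1 - `|x|).

Lemma continuous_bump k : continuous (bump k).
Proof.
apply: continuous_clamp => x; apply: cvgB; first exact: cvg_cst.
by apply: cvg_norm; exact: cvg_id.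
Qed.

Lemma bump_eq0 k x : k + 1 < `|x| -> bump k x = 0.
Proof. by move=> kx; apply: clamp_le0; rewrite subr_le0 ltW. Qed.

Lemma bump_eq1 k x : `|x| <= k -> bump k x = 1.
Proof. by move=> xk; apply: clamp_ge1; rewrite addrAC lerDr subr_ge0. Qed.

End clamp.

(** * Gaussian expectations of bounded test functions *)

Section gaussian_expectation.
Variable R : realType.
Notation mu := (@lebesgue_measure R).
Notation phi := (normal_pdf (0 : R) 1).
Implicit Types h : R -> R.

Definition gaussE h : R := (\int[mu]_x (h x * phi x))%R.

Lemma gaussE_le h1 h2 (B1 B2 : R) : measurable_fun setT h1 ->
  measurable_fun setT h2 -> (forall x, `|h1 x| <= B1) ->
  (forall x, `|h2 x| <= B2) -> (forall x, h1 x <= h2 x) ->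
  gaussE h1 <= gaussE h2.
Proof.
move=> m1 m2 b1 b2 h12; apply: le_Rintegral => //.
- exact: integrableM_normal_pdf b1.
- exact: integrableM_normal_pdf b2.
by move=> x _; rewrite ler_wpM2r// normal_pdf_ge0.
Qed.

Lemma gaussE_cst (r : R) : gaussE (fun=> r) = r.
Proof.
have iphi : mu.-integrable setT (EFin \o phi) by exact: integrable_normal_pdf.
rewrite /gaussE (RintegralZl r measurableT iphi).
by rewrite /Rintegral integral_normal_pdf mulr1.
Qed.

Lemma gaussE_ge0 h : (forall x, 0 <= h x) -> 0 <= gaussE h.
Proof.
move=> h0; apply: Rintegral_ge0 => x _.
by rewrite mulr_ge0// normal_pdf_ge0.
Qed.

Lemma gaussE_le1 h : measurable_fun setT h -> (forall x, 0 <= h x <= 1) ->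
  gaussE h <= 1.
Proof.
move=> mh h01; rewrite -[leRHS]gaussE_cst.
apply: (@gaussE_le _ _ 1 1) => // x.
- by have /andP[h0 h1] := h01 x; rewrite ger0_norm.
- by rewrite normr1.
- by have /andP[] := h01 x.
Qed.

(** Dominated convergence, with the density itself as dominating function. *)
Lemma gaussE_cvg_indic (hk : (R -> R)^nat) (D : set R) :
  measurable D -> (forall k, measurable_fun setT (hk k)) ->
  (forall k x, 0 <= hk k x <= 1) ->
  (forall x, hk ^~ x @ \oo --> (\1_D x : R)) ->
  (fun k => gaussE (hk k)) @ \oo --> gaussE \1_D.
Proof.
move=> mD mh h01 hD.
have hb k x : `|hk k x| <= 1 by have /andP[h0 h1] := h01 k x; rewrite ger0_norm.
have iD : mu.-integrable setT (fun x => (\1_D x * phi x)%:E).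
  apply: (@integrableM_normal_pdf _ _ 1) => //.
  by move=> x; rewrite indicE; case: (_ \in _); rewrite ?normr1 ?normr0.
have [] := @dominated_convergence _ _ _ mu setT measurableT
  (fun k x => (hk k x * phi x)%:E) (fun x => (\1_D x * phi x)%:E)
  (fun x => (phi x)%:E).
- move=> k; apply/measurable_EFinP; apply: measurable_funM.
    exact: mh.
  exact: measurable_normal_pdf.
- by case/integrableP: iD.
- apply: aeW => x _; apply: cvg_EFin; first by near=> k.
  by apply: cvgM; [exact: hD|exact: cvg_cst].
- exact: integrable_normal_pdf.
- apply: aeW => x k _.
  rewrite lee_fin normrM (ger0_norm (normal_pdf_ge0 _ _ _)).
  by rewrite ler_piMl// normal_pdf_ge0.
move=> _ _ hkD; rewrite /gaussE /Rintegral.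
by apply: fine_cvg; rewrite fineK//; exact: integrable_fin_num.
Unshelve. all: by end_near.
Qed.

End gaussian_expectation.

(** * Asymptotic lower bounds for expectations and for probabilities of open sets *)

Section normal_limit.
Variable R : realType.
Variables (d : nat -> measure_display) (T : forall n, measurableType (d n)).
Variables (P : forall n, probability (T n) R) (W : forall n, {mfun T n >-> R}).
Local Notation E n F := (\int[P n]_w F w)%R.

Let mW n : measurable_fun setT (W n). Proof. by []. Qed.

Hypothesis iW2 :
  forall n, (P n).-integrable setT (EFin \o (fun w => W n w ^+ 2)).
Hypothesis W2 : forall n, E n (fun w => W n w ^+ 2) = 1.
Hypothesis stein_cvg : forall (f g : R -> R) (A : R),
  continuous g -> (forall x : R, is_derive x 1 f (g x)) ->
  (forall x, A < `|x| -> f x = 0) -> (forall x, A < `|x| -> g x = 0) ->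
  (fun n => E n (fun w => g (W n w) - W n w * f (W n w))) @ \oo --> (0 : R).

Lemma cvg_centered (h : R -> R) (A : R) : continuous h ->
  (forall x, A < `|x| -> h x = 0) -> gaussE h = 0 ->
  (fun n => E n (fun w => h (W n w))) @ \oo --> (0 : R).
Proof.
move=> ch h0 Nh; have [f [g [cg df f0 g0 gE]]] := stein_equation ch h0 Nh.
rewrite (_ : (fun n => _) =
  fun n => E n (fun w => g (W n w) - W n w * f (W n w))).
  exact: stein_cvg cg df f0 g0.
by apply/funext => n; apply: eq_Rintegral => w _; rewrite gE.
Qed.

(** Chebyshev's inequality in functional form: the parabola [1 - k ^- 2 * x ^+ 2] lies below the
    bump everywhere. *)
Lemma bump_expectation_ge (k : R) n : 0 < k ->
  1 - k ^- 2 <= E n (fun w => bump k (W n w)).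
Proof.
move=> k0.
have -> : 1 - k ^- 2 = E n (fun w => 1 - k ^- 2 * W n w ^+ 2).
  rewrite (RintegralB measurableT (intble_cst _ 1) (intbleZ _ (iW2 n))).
  rewrite Rintegral_probability_cst (RintegralZl _ measurableT (iW2 n)).
  by rewrite W2 mulr1.
apply: le_Rintegral => //.
- exact: (intbleB (intble_cst _ 1) (intbleZ _ (iW2 n))).
- apply: (@intble_bounded _ _ _ (P n) (fun w => bump k (W n w)) 1).
    have mb : measurable_fun setT (bump k : R -> R).
      by apply: continuous_measurable_fun; exact: continuous_bump.
    exact: (measurableT_comp mb (@mW n)).
  by move=> w; rewrite ger0_norm ?clamp_ge0 ?clamp_le1.
move=> w _; have [wk|wk] := lerP `|W n w| k.
  rewrite bump_eq1// gerBl// mulr_ge0// ?sqr_ge0//.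
  by rewrite invr_ge0 exprn_ge0// ltW.
rewrite (le_trans _ (clamp_ge0 _))// subr_le0 mulrC.
rewrite ler_pdivlMr ?exprn_gt0// mul1r -[leRHS]real_normK ?num_real//.
by apply: lerXn2r; rewrite ?nnegrE// ltW.
Qed.

(** Subtracting [c * b] centers [h], so the mean of [h (W n w)] is asymptotically [c] times that of
    the bump, which is at least [c * (1 - k ^- 2)]; moreover [c] is at least [gaussE h] because
    [gaussE b <= 1]. *)
Lemma expectation_ge_gaussE (h : R -> R) (A : R) : continuous h ->
  (forall x, A < `|x| -> h x = 0) -> (forall x, 0 <= h x <= 1) ->
  forall e, 0 < e ->
  \forall n \near \oo, gaussE h - e <= E n (fun w => h (W n w)).
Proof.
move=> ch h0 h01 e e0.
have mh : measurable_fun setT h by exact: continuous_measurable_fun.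
(* The first entry keeps the bump's expectation at least 1/2; the second makes the loss [k ^- 2] at
   most [e / 2]. The other [e / 2] is spent on the centered function. *)
pose k : R := Num.max 2 (2 / e).
have k2 : 2 <= k by rewrite le_max lexx.
have k0 : 0 < k by rewrite (lt_le_trans _ k2).
have k0' := ltW k0.
have kV1 : k ^- 2 <= 1 / 2.
  rewrite div1r lef_pV2 ?posrE ?exprn_gt0//.
  by rewrite expr2 (le_trans k2)// ler_peMl// (le_trans _ k2)// ler1n.
have kVe : k ^- 2 <= e / 2.
  have ke : 2 / e <= k by rewrite le_max lexx orbT.
  rewrite -[leRHS]invrK invf_div lef_pV2 ?posrE ?exprn_gt0 ?divr_gt0//.
  by rewrite expr2 (le_trans ke)// ler_peMl// (le_trans _ k2)// ler1n.
pose b := bump k : R -> R.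
have cb : continuous b by exact: continuous_bump.
have mb : measurable_fun setT b by exact: continuous_measurable_fun.
have b01 x : 0 <= b x <= 1 by rewrite clamp_ge0 clamp_le1.
have Eb n := bump_expectation_ge n k0.
have Nh0 : 0 <= gaussE h by apply: gaussE_ge0 => x; case/andP: (h01 x).
have Nh1 : gaussE h <= 1 by exact: gaussE_le1.
have Nb0 : 0 <= gaussE b by apply: gaussE_ge0 => x; case/andP: (b01 x).
have Nb1 : gaussE b <= 1 by exact: gaussE_le1.
(* Otherwise [b] is centered, and [E n b] would tend to 0. *)
have {}Nb0 : 0 < gaussE b.
  rewrite lt_neqAle Nb0 andbT; apply/eqP => /esym b0.
  have /cvgrPdist_lt /(_ (1 / 2)) := cvg_centered cb (@bump_eq0 _ k) b0.
  rewrite divr_gt0// => /(_ isT) [N _ /(_ N (leqnn N))] /=.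
  by have := Eb N; rewrite sub0r normrN -/b => + /ltr_normlW; lra.
pose c := gaussE h / gaussE b.
have ch_le : gaussE h <= c by rewrite ler_pdivlMr// ler_piMr.
have c0 : 0 <= c by rewrite divr_ge0// ltW.
pose hc x := h x - c * b x.
have chc : continuous hc.
  by move=> x; apply: cvgB; [exact: ch|apply: cvgM; [exact: cvg_cst|exact: cb]].
have hc0 x : Num.max A (k + 1) < `|x| -> hc x = 0.
  by rewrite gt_max => /andP[Ax kx]; rewrite /hc h0// /b bump_eq0// mulr0 subrr.
have hb x : `|h x| <= 1 by have /andP[? ?] := h01 x; rewrite ger0_norm.
have bb x : `|b x| <= 1 by have /andP[? ?] := b01 x; rewrite ger0_norm.
have Nhc : gaussE hc = 0.
  rewrite /gaussE.
  under eq_Rintegral => x _ do rewrite /hc mulrBl -mulrA.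
  have ih := integrableM_normal_pdf mh hb.
  have ib := integrableM_normal_pdf mb bb.
  rewrite (RintegralB measurableT ih (integrableZl measurableT c ib)).
  rewrite (RintegralZl c measurableT ib) -/(gaussE h) -/(gaussE b).
  by rewrite /c divfK ?subrr// gt_eqF.
have /cvgrPdist_lt /(_ (e / 2)) := cvg_centered chc hc0 Nhc.
rewrite divr_gt0// => /(_ isT); apply: filterS => n.
rewrite sub0r normrN ltr_norml => /andP[hcn _].
have ihW : (P n).-integrable setT (EFin \o (fun w => h (W n w))).
  apply: (@intble_bounded _ _ _ (P n) (fun w => h (W n w)) 1) => //.
  exact: (measurableT_comp mh (@mW n)).
have ibW : (P n).-integrable setT (EFin \o (fun w => b (W n w))).
  apply: (@intble_bounded _ _ _ (P n) (fun w => b (W n w)) 1) => //.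
  exact: (measurableT_comp mb (@mW n)).
have hcE : E n (fun w => hc (W n w)) =
    E n (fun w => h (W n w)) - c * E n (fun w => b (W n w)).
  rewrite (RintegralB measurableT ihW (intbleZ c ibW)).
  by rewrite (RintegralZl c measurableT ibW).
rewrite hcE in hcn.
have cEb : c * (1 - k ^- 2) <= c * E n (fun w => b (W n w)).
  by rewrite ler_wpM2l.
have hk1 : gaussE h * (1 - k ^- 2) <= c * (1 - k ^- 2).
  by rewrite ler_wpM2r//; lra.
have hk2 : gaussE h * k ^- 2 <= e / 2.
  by rewrite (le_trans _ kVe)// ler_piMl// invr_ge0 exprn_ge0// ltW.
lra.
Qed.

(** The open-set half of the portmanteau theorem: the indicator of [0 < u] is approximated from
    below by continuous functions of compact support. *)
Lemma probability_gt0_ge_gaussE (u : R -> R) : continuous u ->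
  forall e, 0 < e -> \forall n \near \oo,
    gaussE \1_[set x | 0 < u x] - e <= fine (P n [set w | 0 < u (W n w)]).
Proof.
move=> cu e e0.
have mu0 : measurable [set x : R | 0 < u x].
  have -> : [set x | 0 < u x] = u @^-1` `]0, +oo[%classic.
    by apply/seteqP; split => x /=; rewrite in_itv/= andbT.
  rewrite -[X in measurable X]setTI; exact: continuous_measurable_fun.
(* The first factor vanishes off the open set and reaches 1 once [k] exceeds [1 / u x]; the second
   gives compact support and is 1 once [k] exceeds [|x|]. *)
pose h (k : nat) (x : R) := clamp (k%:R * u x) * bump k%:R x.
have ch k : continuous (h k).
  have cku : continuous (fun y => k%:R * u y).
    by move=> y; apply: cvgM; [exact: cvg_cst|exact: cu].
  move=> x; apply: cvgM; last exact: continuous_bump.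
  exact: (continuous_clamp cku).
have h01 k x : 0 <= h k x <= 1.
  rewrite mulr_ge0 ?clamp_ge0//=.
  by rewrite mulr_ile1 ?clamp_ge0 ?clamp_le1.
have mh k : measurable_fun setT (h k) by exact: continuous_measurable_fun.
have hle k x : ~ (0 < u x) -> h k x = 0.
  move=> /negP; rewrite -leNgt => ux; rewrite /h clamp_le0 ?mul0r//.
  by rewrite mulr_ge0_le0.
have hcvg x : h ^~ x @ \oo --> (\1_[set x | 0 < u x] x : R).
  rewrite indicE; have [|/negP ux] := boolP (x \in [set x | 0 < u x]).
    rewrite inE/= => ux.
    apply: cvg_near_cst; near=> k.
    rewrite /h clamp_ge1 ?bump_eq1 ?mul1r//.
      by near: k; exact: nbhs_infty_ger.
    rewrite -ler_pdivrMr// div1r.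
    by near: k; exact: nbhs_infty_ger.
  apply: cvg_near_cst; near=> k.
  by apply: hle => u0; apply: ux; rewrite inE.
(* The approximation index [N] is fixed before the row index [n], at a cost of [e / 2] on each
   side. *)
have /cvgrPdist_lt /(_ (e / 2)) := gaussE_cvg_indic mu0 mh h01 hcvg.
rewrite divr_gt0// => /(_ isT) [N _ /(_ N (leqnn N))] /=.
rewrite ltr_norml => /andP[_ hN].
have e20 : 0 < e / 2 by rewrite divr_gt0.
have h0 x : N%:R + 1 < `|x| -> h N x = 0.
  by move=> Nx; rewrite /h bump_eq0// mulr0.
have := expectation_ge_gaussE (ch N) h0 (h01 N) e20.
apply: filterS => n Nn.
have mA : measurable [set w | 0 < u (W n w)].
  by rewrite -[X in measurable X]setTI; exact: (@mW n measurableT _ mu0).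
have -> : fine (P n [set w | 0 < u (W n w)]) = E n \1_[set w | 0 < u (W n w)].
  by rewrite /Rintegral integral_indic// setIT.
have hI : E n (fun w => h N (W n w)) <= E n \1_[set w | 0 < u (W n w)].
  apply: le_Rintegral => //.
  - apply: (@intble_bounded _ _ _ (P n) (fun w => h N (W n w)) 1) => //.
      exact: (measurableT_comp (mh N) (@mW n)).
    by move=> w; have /andP[? ?] := h01 N (W n w); rewrite ger0_norm.
  - exact: integrable_indic.
  move=> w _; rewrite indicE; have [_|/negP uw] := boolP (_ \in _).
    by case/andP: (h01 N (W n w)).
  by rewrite hle// => u0; apply: uw; rewrite inE.
lra.
Unshelve. all: by end_near.
Qed.

End normal_limit.

(** * Half-lines and convergence of distribution functions *)

Lemma gaussE_indic (R : realType) (D : set R) : measurable D ->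
  gaussE \1_D = fine (normal_prob 0 1 D).
Proof.
move=> mD; rewrite /normal_prob -/(Rintegral _ _ _) Rintegral_mkcond.
apply: eq_Rintegral => x _; rewrite indicE patchE.
by case: ifPn => _; rewrite ?mul1r ?mul0r.
Qed.

(** The half-line may be closed because a law with a Lebesgue density gives the endpoint no mass. *)
Lemma gaussE_lt (R : realType) (x : R) :
  gaussE \1_[set t | 0 < x - t] = fine (normal_prob 0 1 `]-oo, x]).
Proof.
have -> : [set t | 0 < x - t] = `]-oo, x[%classic.
  by apply/seteqP; split => t; rewrite /= in_itv/= subr_gt0.
rewrite gaussE_indic//; congr fine; apply: integral_itv_bndo_bndc.
apply/measurable_funTS/measurable_EFinP; exact: measurable_normal_pdf.
Qed.

Lemma gaussE_gt (R : realType) (x : R) :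
  gaussE \1_[set t | 0 < t - x] = 1 - fine (normal_prob 0 1 `]-oo, x]).
Proof.
have -> : [set t | 0 < t - x] = ~` `]-oo, x]%classic.
  apply/seteqP; split => t; rewrite /= in_itv/= subr_gt0.
    by move=> xt; apply/negP; rewrite -ltNge.
  by move=> /negP; rewrite -ltNge.
rewrite gaussE_indic; last exact: measurableC.
have -> : normal_prob 0 1 (~` `]-oo, x]) =
    (1 - normal_prob 0 1 `]-oo, x])%E :> \bar R.
  exact: probability_setC.
rewrite fineB//; exact: (fin_num_measure (normal_prob 0 1)).
Qed.

(** The open half-line below [x] bounds the distribution function from below; the one above [x],
    through its complement, bounds it from above. *)
Lemma cvg_normal_cdf (R : realType)
    (d : nat -> measure_display) (T : forall n, measurableType (d n))
    (P : forall n, probability (T n) R) (W : forall n, {mfun T n >-> R}) :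
  (forall n, (P n).-integrable setT (EFin \o (fun w => W n w ^+ 2))) ->
  (forall n, (\int[P n]_w (W n w ^+ 2))%R = 1) ->
  (forall (f g : R -> R) (A : R),
    continuous g -> (forall x : R, is_derive x 1 f (g x)) ->
    (forall x, A < `|x| -> f x = 0) -> (forall x, A < `|x| -> g x = 0) ->
    (fun n => \int[P n]_w (g (W n w) - W n w * f (W n w)))%R @ \oo
      --> (0 : R)) ->
  forall x, P n [set w | W n w <= x] @[n --> \oo] --> normal_prob 0 1 `]-oo, x].
Proof.
move=> iW2 W2 stein_cvg x.
have np_fin : normal_prob 0 1 `]-oo, x] \is a @fin_num R.
  exact: (fin_num_measure (normal_prob 0 1)).
rewrite -(fineK np_fin); set p := fine _.
have mW n (D : set R) : measurable D -> measurable (W n @^-1` D).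
  by move=> mD; rewrite -[X in measurable X]setTI; exact: measurable_funP.
have mle n : measurable [set w | W n w <= x].
  have -> : [set w | W n w <= x] = W n @^-1` `]-oo, x]%classic.
    by apply/seteqP; split => w; rewrite /= in_itv.
  exact: mW.
have mlt n : measurable [set w | 0 < x - W n w].
  have -> : [set w | 0 < x - W n w] = W n @^-1` `]-oo, x[%classic.
    by apply/seteqP; split => w; rewrite /= in_itv/= subr_gt0.
  exact: mW.
apply: cvg_EFin; first by near=> n; exact: fin_num_measure.
apply/cvgrPdist_le => e e0.
have cu1 : continuous (fun t => x - t).
  by move=> t; apply: cvgB; [exact: cvg_cst|exact: cvg_id].
have cu2 : continuous (fun t => t - x).
  by move=> t; apply: cvgB; [exact: cvg_id|exact: cvg_cst].
have := probability_gt0_ge_gaussE iW2 W2 stein_cvg cu1 e0.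
have := probability_gt0_ge_gaussE iW2 W2 stein_cvg cu2 e0.
apply: filterS2 => n; rewrite gaussE_lt gaussE_gt -/p => h2 h1.
(* Only an inequality, since [W n] may have an atom at [x]. *)
have h3 : fine (P n [set w | 0 < x - W n w]) <= fine (P n [set w | W n w <= x]).
  rewrite fine_le ?fin_num_measure// le_measure ?inE// => w /=.
  by rewrite subr_gt0 => /ltW.
have h4 : fine (P n [set w | 0 < W n w - x]) =
    1 - fine (P n [set w | W n w <= x]).
  have -> : [set w | 0 < W n w - x] = ~` [set w | W n w <= x].
    apply/seteqP; split => w; rewrite /= subr_gt0.
      by move=> xt; apply/negP; rewrite -ltNge.
    by move=> /negP; rewrite -ltNge.
  by rewrite probability_setC// fineB// fin_num_measure.
rewrite /= ler_norml; apply/andP; split; lra.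
Unshelve. all: by end_near.
Qed.

Theorem theorem3 (R : realType)
    (d : nat -> measure_display) (T : forall n, measurableType (d n))
    (P : forall n, probability (T n) R)
    (m : nat -> nat) (X : forall n, 'I_(m n) -> {RV (P n) >-> R})
    (dZ : measure_display) (TZ : measurableType dZ) (Q : probability TZ R)
    (Z : {RV Q >-> R})
    (X_indep : forall n, independent_RVs (P n) (X n))
    (X_mean0 : forall n (i : 'I_(m n)), ('E_(P n)[X n i] = 0)%E)
    (Z_normal : standard_normal Q Z)
    (X_var1 : forall n,
       (\sum_(i < m n) 'E_(P n)[fun w => ((X n i w) ^+ 2)%R] = 1)%E)
    (lindeberg : forall delta : R, 0 < delta ->
       (\sum_(i < m n) expectation_on (P n) (fun w => (X n i w) ^+ 2)%R
          [set w | (`|X n i w| > delta)%R])%E @[n --> \oo] --> 0%E) :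
  forall x : R,
    P n [set w | \sum_(i < m n) X n i w <= x] @[n --> \oo]
      --> Q [set w | Z w <= x].
Proof.
move=> x.
have -> : Q [set w | Z w <= x] = normal_prob 0 1 `]-oo, x].
  have -> : [set w | Z w <= x] = Z @^-1` `]-oo, x]%classic.
    by apply/seteqP; split => w; rewrite /= in_itv.
  exact: Z_normal.
have EX2 n i : ('E_(P n)[fun w => (X n i w ^+ 2)%R] =
    \int[P n]_w (X n i w ^+ 2)%:E)%E.
  by rewrite unlock.
(* Square integrability comes from the variance condition: each second moment is a term of a
   nonnegative sum equal to 1. *)
have iX2 n i : (P n).-integrable setT (EFin \o (fun w => X n i w ^+ 2)).
  apply/integrableP; split.
    by apply/measurable_EFinP; exact: measurable_funX.
  under eq_integral => w _ do rewrite /= ger0_norm ?sqr_ge0//.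
  apply: (@le_lt_trans _ _ 1%E); last exact: ltry.
  rewrite -(X_var1 n) (bigD1 i)//= EX2 leeDl// sume_ge0// => j _.
  by rewrite EX2 integral_ge0// => w _; rewrite lee_fin sqr_ge0.
have mean0 n i : (\int[P n]_w X n i w)%R = 0.
  by have := X_mean0 n i; rewrite unlock /Rintegral => ->.
have var1 n : \sum_i (\int[P n]_w (X n i w ^+ 2))%R = 1.
  rewrite sum_fine; last first.
    by move=> i _; exact: (integrable_fin_num measurableT (iX2 n i)).
  by have := X_var1 n; under eq_bigr do rewrite EX2; move=> ->.
have mW n : measurable_fun setT (fun w => \sum_i X n i w).
  exact: measurable_sum.
pose W n : {mfun T n >-> R} := mfun_Sub (mem_set (mW n)).
have W2 n := sum_sqr_expectation (X_indep n) (iX2 n) (mean0 n) (var1 n).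
apply: (@cvg_normal_cdf R d T P W) => [n|n|f g A cg df f0 g0].
- by case: (W2 n).
- by case: (W2 n).
have cf := is_derive_continuous df.
have [Bf _ fB] := compact_support_bounded cf f0.
have [B B0 gB] := compact_support_bounded cg g0.
apply/cvgrPdist_le => e e0.
(* The modulus of continuity enters [stein_bound] twice, hence [e / 4]. As [dl] and the constant [K]
   do not depend on [n], the Lindeberg condition at [dl] brings the remaining term below [e / 2]. *)
have e40 : 0 < e / 4 by rewrite divr_gt0.
have [dl dl0 ge] := compact_support_unif_continuous cg g0 e40.
pose L n := \sum_i
  (\int[P n]_w (X n i w ^+ 2 * \1_[set w | dl < `|X n i w|] w))%R.
have L0 : L n @[n --> \oo] --> (0 : R).
  have /fine_cvgP[_] := lindeberg dl dl0.
  rewrite (_ : _ \o _ = L)//; apply/funext => n.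
  rewrite /L sum_fine; last first.
    move=> i _.
    exact: (integrable_fin_num measurableT (intble_sqr_tail dl (iX2 n i))).
  by congr fine; apply: eq_bigr => i _; rewrite /expectation_on unlock.
pose K := 2 * B * (1 + dl ^- 2).
have KL0 : K * L n @[n --> \oo] --> (0 : R).
  by rewrite -(mulr0 K); apply: cvgM; [exact: cvg_cst|exact: L0].
have /cvgrPdist_le /(_ (e / 2)) := KL0.
rewrite divr_gt0// => /(_ isT); apply: filterS => n.
rewrite !sub0r !normrN => KLn.
have := stein_bound (X_indep n) (iX2 n) (mean0 n) (var1 n) cg df fB gB
  (ltW e40) dl0 ge.
rewrite -/(L n) -/K => /le_trans; apply.
have := le_trans (ler_norm _) KLn; lra.
Qed.
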